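(* Let $m,\ell\ge 2$ be integers with $\ell\le m$. Then the strict inequalities $$p_{1}(\ell,m) < \cdots < p_{\lfloor \ell m/2\rfloor}(\ell,m) = p_{\lceil \ell m/2\rceil}(\ell,m) > \cdots > p_{\ell m-1}(\ell,m)$$ hold if and only if either $\ell=m=2$, or $\ell,m\ge 5$ and $(\ell,m)$ is not one of $$(5,6),\ (5,10),\ (5,14),\ (6,6),\ (6,7),\ (6,9),\ (6,11),\ (6,13),\ (7,10).$$
   Context: For nonnegative integers $\ell, m$, the numbers $p_n(\ell,m)$ are defined by $$\binom{m+\ell}{m}_q = \frac{(q^{m+1}-1)\cdots(q^{m+\ell}-1)}{(q-1)\cdots(q^{\ell}-1)} = \sum_{n=0}^{\ell m} p_n(\ell,m)\, q^n,$$ so $p_n(\ell,m)$ is the number of partitions of $n$ whose Young diagram fits inside an $\ell\times m$ rectangle. *)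

(* Defs.v *)
From mathcomp Require Import all_boot all_order all_algebra ring.
Set Implicit Arguments.
Unset Strict Implicit.
Unset Printing Implicit Defensive.
Import Order.TTheory GRing.Theory Num.Theory.
Local Open Scope ring_scope.

Definition gauss_num (l m : nat) : {poly int} :=
  \prod_(1 <= i < l.+1) ('X^(m + i) - 1).

Definition gauss_den (l : nat) : {poly int} :=
  \prod_(1 <= i < l.+1) ('X^i - 1).

(* The denominator is monic, so %/ is Euclidean division over int; it is exact
   by [gauss_binomE], so no remainder is discarded. *)
Definition gauss_binom (l m : nat) : {poly int} :=
  gauss_num l m %/ gauss_den l.

Definition pcoef (l m n : nat) : int := (gauss_binom l m)`_n.

Definition strict_chain (l m : nat) : Prop :=
  [/\ (forall n : nat, (1 <= n)%N -> (n < (l * m)./2)%N ->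
         pcoef l m n < pcoef l m n.+1),
      pcoef l m (l * m)./2 = pcoef l m (uphalf (l * m)) &
      (forall n : nat, (uphalf (l * m) <= n)%N -> (n < (l * m).-1)%N ->
         pcoef l m n.+1 < pcoef l m n)].

Definition exceptional : seq (nat * nat) :=
  [:: (5, 6); (5, 10); (5, 14); (6, 6); (6, 7); (6, 9); (6, 11); (6, 13);
      (7, 10)]%N.

Lemma gauss_den_monic l : gauss_den l \is monic.
Proof.
rewrite /gauss_den big_nat; apply: monic_prod => i /andP[i_gt0 _].
exact: monicXnsubC.
Qed.

Lemma gauss_num_dvd l m : exists g, gauss_num l m = g * gauss_den l.
Proof.
elim: l m => [|l IHl] m.
  by exists 1; rewrite /gauss_num /gauss_den !big_geq // mul1r.
elim: m => [|m [g Eg]]; first by exists 1; rewrite mul1r.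
have [h Eh] := IHl m.+1.
exists ('X^(m.+1) * h + g); rewrite mulrDl -Eg.
have -> : gauss_num l.+1 m = ('X^(m.+1) - 1) * gauss_num l m.+1.
  rewrite /gauss_num big_nat_recl // addn1; congr (_ * _).
  by apply: eq_big_nat => i _; rewrite addnS addSn.
have -> : gauss_num l.+1 m.+1 = gauss_num l m.+1 * ('X^(m.+1 + l.+1) - 1).
  by rewrite /gauss_num big_nat_recr.
have -> : gauss_den l.+1 = gauss_den l * ('X^(l.+1) - 1).
  by rewrite /gauss_den big_nat_recr.
by rewrite Eh exprD; ring.
Qed.

Lemma gauss_binomE l m : gauss_binom l m * gauss_den l = gauss_num l m.
Proof.
have [g Eg] := gauss_num_dvd l m.
by rewrite /gauss_binom Eg Pdiv.IdomainMonic.mulpK ?gauss_den_monic.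
Qed.

(* Main.v *)
(* Let [p_k] be the number of partitions of [k] in an [l x m] box, which is
   also the number of monomials of degree [m] and weight [k] in [x_0, ..., x_l],
   where [x_i] has weight [l - i].  The derivations [x_i |-> (l - i) x_(i+1)]
   (lowering) and [x_i |-> i x_(i-1)] (raising) make [rat[x_0, ..., x_l]] an
   sl2-module, and [lowering o raising] is injective in weight [k - 1] when
   [2k <= lm].  Hence, for such [k], [p_(k-1) < p_k] iff some nonzero polynomial
   of degree [m] and weight [k] is killed by lowering.  Such polynomials are
   closed under products, so strictness for [(l, a)] and [(l, b)] yields
   strictness for [(l, a + b)] when [l * b] is even.  Taking [b = 8] and using
   the symmetry in [l] and [m] leaves finitely many boxes, which are computed.
   For [l <= 4] (other than [l = m = 2]) an equality [p_(k-1) = p_k] is found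
   from recurrences in [m]. *)
From HB Require Import structures.
Require Import Defs.
From Stdlib Require Import NArith.
From mathcomp Require Import all_boot all_order all_algebra ring lra zify.
From mathcomp Require Import mpoly.
Set Implicit Arguments.
Unset Strict Implicit.
Unset Printing Implicit Defensive.
Import Order.TTheory GRing.Theory Num.Theory.

(** * The sl2 action on polynomials *)

Section Derivations.
Local Open Scope ring_scope.
Variables (R : comNzRingType) (n : nat).
Implicit Types (a b : 'I_n -> {mpoly R[n]}) (c : 'I_n -> R).
Implicit Types (p q : {mpoly R[n]}).

Definition der a p := \sum_(i < n) a i * p^`M(i).

Lemma derM a p q : der a (p * q) = der a p * q + p * der a q.
Proof.
rewrite /der mulr_suml mulr_sumr -big_split /=; apply: eq_bigr => i _.
by rewrite mderivM; ring.
Qed.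

Lemma der_is_linear a : linear (der a).
Proof.
move=> x p q; rewrite /der scaler_sumr -big_split /=; apply: eq_bigr => i _.
by rewrite mderivD mderivZ mulrDr scalerAr.
Qed.

HB.instance Definition _ a :=
  GRing.isLinear.Build R {mpoly R[n]} {mpoly R[n]} _ (der a) (der_is_linear a).

Lemma eq_der a b : a =1 b -> der a =1 der b.
Proof. by move=> eab p; apply: eq_bigr => i _; rewrite eab. Qed.

Lemma der_eq0 a p : (forall i, a i = 0) -> der a p = 0.
Proof. by move=> a0; rewrite /der big1 // => i _; rewrite a0 mul0r. Qed.

Lemma derZl x a p : der (fun i => x *: a i) p = x *: der a p.
Proof. by rewrite /der scaler_sumr; apply: eq_bigr => i _; rewrite scalerAl. Qed.

Lemma derDl a b p : der (fun i => a i + b i) p = der a p + der b p.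
Proof. by rewrite -big_split /=; apply: eq_bigr => i _; rewrite mulrDl. Qed.

Lemma derX a i : der a 'X_i = a i.
Proof.
have UU : (U_(i) - U_(i) = 0 :> 'X_{1..n})%MM.
  by apply/mnmP=> j; rewrite !mnmE subnn.
rewrite /der (bigD1 i) //= mderivX mnm1E eqxx scale1r UU mpolyX0 mulr1.
rewrite big1 ?addr0 // => j; rewrite eq_sym => ji.
by rewrite mderivX mnm1E (negbTE ji) scale0r mulr0.
Qed.

(** Symmetry of second partial derivatives cancels all second-order terms, so the commutator is
    again a derivation, fixed by its values on the variables. *)
Lemma der_commutator a b p :
  der a (der b p) - der b (der a p) =
  der (fun i => der a (b i) - der b (a i)) p.
Proof.
have E u v : der u (der v p) = der (fun i => der u (v i)) p
    + \sum_i \sum_j v i * (u j * p^`M(i)^`M(j)).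
  rewrite {2}/der linear_sum /= /der -big_split /=; apply: eq_bigr => i _.
  rewrite -/(der u _) derM; congr (_ + _).
  by rewrite /der mulr_sumr.
rewrite !E.
have -> : \sum_i \sum_j a i * (b j * p^`M(i)^`M(j)) =
          \sum_i \sum_j b i * (a j * p^`M(i)^`M(j)).
  rewrite exchange_big /=; apply: eq_bigr => i _; apply: eq_bigr => j _.
  by rewrite mderiv_comm; ring.
rewrite opprD addrACA subrr addr0 /der -sumrB; apply: eq_bigr => i _.
by rewrite mulrBl.
Qed.

(** A diagonal operator: monomials are its eigenvectors, and degree and weight become
    eigenvalues. *)
Definition euler c := der (fun i => c i *: 'X_i).

Lemma eulerX c (u : 'X_{1..n}) : euler c 'X_[u] = (\sum_i c i *+ u i) *: 'X_[u].
Proof.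
rewrite scaler_suml; apply: eq_bigr => i _; rewrite mderivX.
have [u0|u0] := posnP (u i); first by rewrite u0 scale0r mulr0 mulr0n scale0r.
rewrite -scalerAl -scalerAr scalerA mulr_natr -mpolyXD addmC submK //.
by rewrite lep1mP -lt0n.
Qed.

Lemma mcoeff_euler c p (u : 'X_{1..n}) :
  (euler c p)@_u = (\sum_i c i *+ u i) * p@_u.
Proof.
rewrite [in LHS](mpolyE p) [in RHS](mpolyE p) /euler.
rewrite [der _ _]linear_sum !raddf_sum mulr_sumr /=; apply: eq_bigr => v _.
rewrite linearZ /= -/(euler c _) eulerX !mcoeffZ mcoeffX.
by case: eqP => [->|_]; rewrite ?mulr0 // !mulr1 mulrC.
Qed.

End Derivations.

(** * The sl2 operators and isobaric polynomials *)

Section Sl2.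
Local Open Scope ring_scope.
Variable l : nat.
Local Notation P := {mpoly rat[l.+1]}.
Implicit Types (p q : P) (d k : rat).

(** At [i = l] the index [inord i.+1] falls back to 0, but there the coefficient [l - i]
    vanishes. *)
Definition lowering : P -> P := der (fun i => (l - i)%:R *: 'X_(inord i.+1)).
Definition raising : P -> P := der (fun i => (i : nat)%:R *: 'X_(inord i.-1)).
Definition degop : P -> P := euler (fun _ => 1).
Definition wtop : P -> P := euler (fun i => (l - i)%:R).

(** Eigenvalue equations propagate through products by the Leibniz rule and through operators by
    commutators. Rational weights may become negative. *)
Definition isobaric d k p := degop p = d *: p /\ wtop p = k *: p.

Lemma isobaricM d1 k1 d2 k2 p q :
  isobaric d1 k1 p -> isobaric d2 k2 q -> isobaric (d1 + d2) (k1 + k2) (p * q).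
Proof.
move=> [dp wp] [dq wq]; split.
  rewrite /degop /euler derM -!/(euler _ _) -!/(degop _) dp dq.
  by rewrite -scalerAl -scalerAr scalerDl.
rewrite /wtop /euler derM -!/(euler _ _) -!/(wtop _) wp wq.
by rewrite -scalerAl -scalerAr scalerDl.
Qed.

Lemma isobaric_sum (I : finType) (v : I -> rat) (F : I -> P) d k :
  (forall i, isobaric d k (F i)) -> isobaric d k (\sum_i v i *: F i).
Proof.
move=> hF; split; rewrite /degop /wtop /euler linear_sum scaler_sumr /=;
  apply: eq_bigr => i _; rewrite linearZ /= -/(euler _ _) -/(degop _) -/(wtop _);
  have [h1 h2] := hF i; by rewrite ?h1 ?h2 !scalerA mulrC.
Qed.

(** The sl2 relation: both sides are derivations, and both multiply [x_i] by [2i - l]. *)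
Lemma lowering_raising p :
  lowering (raising p) - raising (lowering p) = l%:R *: degop p - 2 *: wtop p.
Proof.
rewrite /lowering /raising der_commutator -scaleNr -!derZl -derDl.
apply: eq_der => i; rewrite !linearZ /= !derX !scalerA.
have [il|il] := ltnP i l.
  rewrite (@inordK l i.+1) //= inord_val.
  have [i0|i0] := posnP i.
    rewrite i0 mul0r scale0r -!scalerDl add0r scalerN scalerA -scaleNr.
    by congr (_ *: _); rewrite subn0; ring.
  rewrite (@inordK l i.-1) ?prednK ?inord_val; [|lia..].
  rewrite scalerN scalerA -scaleNr -!scalerDl; congr (_ *: _).
  have -> : (l - i.-1 = (l - i).+1)%N by lia.
  by rewrite natrB 1?ltnW // !mulrSr natrB 1?ltnW //; ring.
have il' : i = l :> nat by have := ltn_ord i; lia.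
rewrite il' subnn mul0r !scale0r !addr0 mul1r.
have [l0|l0] := posnP l.
  by have -> : l%:R = 0 :> rat by [rewrite {1}l0]; rewrite mul0r !scale0r.
rewrite (@inordK l l.-1) ?prednK //.
have -> : inord l = i by apply: val_inj; rewrite /= inordK.
by have -> : (l - l.-1 = 1)%N by [lia]; rewrite mulr1.
Qed.

Lemma commutator_eigen (a : P -> P) c x p :
  a (lowering p) - lowering (a p) = c *: lowering p -> a p = x *: p ->
  a (lowering p) = (x + c) *: lowering p.
Proof.
move=> /(canRL (subrK _)) -> ->.
by rewrite /lowering [der _ (_ *: _)]linearZ /= -scalerDl addrC.
Qed.

Lemma isobaric_lowering d k p :
  isobaric d k p -> isobaric d (k - 1) (lowering p).
Proof.
case=> dp wp; split.
  have -> : d = d + 0 by rewrite addr0.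
  apply: (commutator_eigen _ dp); rewrite scale0r /degop /lowering /euler.
  rewrite der_commutator der_eq0 // => i.
  by rewrite !linearZ /= !derX !scale1r subrr.
apply: (commutator_eigen _ wp); rewrite /wtop /lowering /euler.
rewrite der_commutator -derZl; apply: eq_der => i.
rewrite !linearZ /= !derX.
have [il|il] := ltnP i l; last first.
  by have -> : (l - i = 0)%N by [lia]; rewrite !scale0r ?scaler0 addr0.
rewrite inordK // scalerN !scalerA -scalerBl; congr (_ *: _).
have -> : (l - i = (l - i.+1).+1)%N by lia.
by rewrite mulrSr; ring.
Qed.

Lemma isobaric_raising d k p : isobaric d k p -> isobaric d (k + 1) (raising p).
Proof.
case=> dp wp; split.
  have /(canRL (subrK _)) -> : degop (raising p) - raising (degop p) = 0.
    rewrite /degop /raising /euler der_commutator der_eq0 // => i.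
    by rewrite !linearZ /= !derX !scale1r subrr.
  by rewrite dp /raising linearZ add0r.
have /(canRL (subrK _)) -> : wtop (raising p) - raising (wtop p) = raising p.
  rewrite /wtop /raising /euler der_commutator; apply: eq_der => i.
  rewrite !linearZ /= !derX.
  have [i0|i0] := posnP i; first by rewrite i0 !scale0r oppr0 scaler0 addr0.
  rewrite inordK; last by have := ltn_ord i; lia.
  rewrite scalerN !scalerA -scalerBl; congr (_ *: _).
  have -> : (l - i.-1 = (l - i).+1)%N by have := ltn_ord i; lia.
  by rewrite mulrSr; ring.
by rewrite wp /raising [der _ (_ *: _)]linearZ /= scalerDl scale1r addrC.
Qed.

Lemma isobaric_mcoeff d k p u : isobaric d k p -> p@_u != 0 ->
  (mdeg u)%:R = d /\ (\sum_(i < l.+1) (l - i) * u i)%:R = k.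
Proof.
case=> dp wp pu; split; apply: (mulIf pu).
  rewrite -[RHS]mcoeffZ -dp mcoeff_euler; congr (_ * _).
  by rewrite mdegE natr_sum.
rewrite -[RHS]mcoeffZ -wp mcoeff_euler; congr (_ * _).
by rewrite natr_sum; apply: eq_bigr => i _; rewrite natrM mulr_natr.
Qed.

Lemma isobaricX (u : 'X_{1..l.+1}) :
  isobaric (mdeg u)%:R (\sum_(i < l.+1) (l - i) * u i)%:R 'X_[u].
Proof.
split; rewrite /degop /wtop eulerX; congr (_ *: _).
  by rewrite mdegE natr_sum.
by rewrite natr_sum; apply: eq_bigr => i _; rewrite natrM mulr_natr.
Qed.

Lemma isobaric_lt0 d k p : isobaric d k p -> k < 0 -> p = 0.
Proof.
move=> hp k0; apply/mpolyP => u; rewrite mcoeff0; apply/eqP/negPn/negP => pu.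
have [_ kE] := isobaric_mcoeff hp pu.
by move: k0; rewrite -kE ltrn0.
Qed.

(* If [lowering (raising p) = 0], then [raising (lowering^(i+1) p)] is a
   negative multiple of [lowering^i p] for every [i], so no [lowering^i p]
   vanishes unless [p = 0]; but their weights become negative. *)
Lemma lowering_raising_inj (d k : nat) p : isobaric d%:R k%:R p ->
  (2 * k < l * d)%N -> lowering (raising p) = 0 -> p = 0.
Proof.
move=> hp kd p0; apply/eqP/negPn/negP => pn0.
pose g i := iter i lowering p.
have hg i : isobaric d%:R (k%:R - i%:R) (g i).
  elim: i => [|i IH]; first by rewrite subr0.
  by rewrite mulrSr opprD addrA; apply: isobaric_lowering.
have kd' : 2 * k%:R < l%:R * d%:R :> rat by rewrite -!natrM ltr_nat.
have comm i : lowering (raising (g i)) - raising (g i.+1) =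
    (l%:R * d%:R - 2 * (k%:R - i%:R)) *: g i.
  rewrite lowering_raising; have [-> ->] := hg i.
  by rewrite !scalerA -scalerBl.
(* The constant is the sum of [l d - 2 (k - j)] over [j <= i], positive since [2 k < l d]. *)
have step i : exists2 c : rat, 0 < c & raising (g i.+1) = - c *: g i.
  elim: i => [|i [c c0 IH]].
    exists (l%:R * d%:R - 2 * k%:R); first by rewrite subr_gt0.
    have := comm 0%N; rewrite p0 subr0 sub0r => /(canRL (@opprK _)) ->.
    by rewrite scaleNr.
  exists (c + (l%:R * d%:R - 2 * (k%:R - i.+1%:R))).
    by have i0 : 0 <= i.+1%:R :> rat by []; lra.
  have := comm i.+1; rewrite IH {1}/lowering linearZ /=.
  rewrite -/(lowering _) => /(canRL (subKr _)) ->.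
  by rewrite -scalerBl; congr (_ *: _); ring.
have gn0 i : g i != 0.
  elim: i => // i gi; have [c c0 E] := step i.
  apply: contra_neq gi => gi; move: E; rewrite gi /raising linear0 => /esym/eqP.
  by rewrite scaler_eq0 oppr_eq0 (gt_eqF c0) => /eqP.
move/eqP: (gn0 k.+1); apply; apply: (isobaric_lt0 (hg k.+1)).
by rewrite mulrSr; lra.
Qed.

End Sl2.

(** * Monomials counted by the Gaussian coefficients *)

(** Counting positions from the end gives entry [i] of a list of length [l + 1] the weight [l - i]
    of [x_i]. *)
Fixpoint seqwt (s : seq nat) : nat :=
  if s is a :: s' then size s' * a + seqwt s' else 0.

(* Exponents [:: a_0; ...; a_l] of the monomials of degree [m] and weight [k]:
   either [a_0 = 0], or a factor [x_0], of weight [l], can be removed. *)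
Fixpoint expseqs (l m k : nat) {struct l} : seq (seq nat) :=
  if l is l'.+1 then
    (fix expseqs_l m k {struct m} :=
       [seq 0 :: s | s <- expseqs l' m k] ++
       (if m is m'.+1 then
          if l' < k then
            [seq (head 0 s).+1 :: behead s | s <- expseqs_l m' (k - l)]
          else [::]
        else [::])) m k
  else if k == 0 then [:: [:: m]] else [::].

Arguments expseqs : simpl never.

Lemma expseqs0l m k : expseqs 0 m k = if k == 0 then [:: [:: m]] else [::].
Proof. by []. Qed.

Lemma expseqsS0 l k : expseqs l.+1 0 k = [seq 0 :: s | s <- expseqs l 0 k].
Proof. by rewrite /expseqs /= cats0. Qed.

Lemma expseqsSS l m k : expseqs l.+1 m.+1 k =
  [seq 0 :: s | s <- expseqs l m.+1 k] ++
  (if l < k then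
     [seq (head 0 s).+1 :: behead s | s <- expseqs l.+1 m (k - l.+1)]
   else [::]).
Proof. by []. Qed.

Definition npart l m k := size (expseqs l m k).

Lemma npart0l m k : npart 0 m k = (k == 0).
Proof. by rewrite /npart expseqs0l; case: eqP. Qed.

Lemma npartl0 l k : npart l 0 k = (k == 0).
Proof.
by elim: l => [|l IH]; rewrite ?npart0l // /npart expseqsS0 size_map.
Qed.

(** The q-Pascal rule, read off the enumeration; it later identifies [npart] with the Gaussian
    coefficients. *)
Lemma npartSS l m k : npart l.+1 m.+1 k =
  npart l m.+1 k + (if l < k then npart l.+1 m (k - l.+1) else 0).
Proof.
by rewrite /npart expseqsSS size_cat size_map; case: ifP; rewrite ?size_map.
Qed.

Lemma npart_weight0 l m : npart l m 0 = 1.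
Proof.
elim: l => [|l IH]; first by rewrite npart0l.
by case: m IH => [|m] IH; [rewrite npartl0|rewrite npartSS IH].
Qed.

(** The head of [s], zero or positive, decides which half of the recursion produces it. *)
Lemma mem_expseqs l m k s :
  (s \in expseqs l m k) = [&& size s == l.+1, sumn s == m & seqwt s == k].
Proof.
elim: l m k s => [|l IHl] m k s.
  have -> : (s \in expseqs 0 m k) = (k == 0) && (s == [:: m]).
    by rewrite expseqs0l; case: (k == 0); rewrite ?inE.
  case: s => [|a [|b s]]; rewrite ?eqseq_cons /= ?andbF //.
  by rewrite andbT addn0 mul0n andbC [0 == k]eq_sym.
elim: m k s => [|m IHm] k s.
  rewrite expseqsS0; case: s => [|a s].
    by apply/negbTE/mapP => -[].
  apply/mapP/idP => [[s' + [-> ->]]|/=].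
    by rewrite IHl /= eqSS muln0 !add0n.
  rewrite eqSS addn_eq0 => /and3P[sz /andP[/eqP a0 s0] wt].
  exists s; last by rewrite a0.
  by move: wt; rewrite IHl sz s0 a0 muln0 add0n.
rewrite expseqsSS mem_cat; case: s => [|a s].
  apply/negbTE; rewrite negb_or; apply/andP; split; first by apply/mapP => -[].
  by case: ifP => // _; apply/mapP => -[].
case: a => [|a].
  rewrite orbC; have -> /= : (0 :: s \in (if l < k then
     [seq (head 0 s).+1 :: behead s | s <- expseqs l.+1 m (k - l.+1)]
     else [::])) = false.
    by case: ifP => // _; apply/negbTE/mapP => -[].
  by rewrite mem_map => [|u v []//]; rewrite IHl eqSS muln0 !add0n.
have -> /= : (a.+1 :: s \in [seq 0 :: s | s <- expseqs l m.+1 k]) = false.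
  by apply/negbTE/mapP => -[].
have E j : [&& size s == l.+1, a + sumn s == m & size s * a + seqwt s == j] =
    (a :: s \in expseqs l.+1 m j).
  by rewrite IHm /= eqSS.
rewrite eqSS addSn eqSS; case: ltnP => lk.
  apply/mapP/idP => [[[|b t] tin [-> ->]]|].
  - by rewrite IHm in tin.
  - move: tin; rewrite IHm /= eqSS => /and3P[/eqP -> -> /eqP wt] /=.
    by rewrite eqxx /=; apply/eqP; lia.
  move=> /and3P[/eqP sz sm /eqP wt]; exists (a :: s) => //.
  by rewrite IHm /= sz sm eqxx /=; apply/eqP; lia.
(* A positive exponent of [x_0] already costs weight [l + 1], which exceeds [k]. *)
apply/esym/negP => /and3P[/eqP sz sm /eqP wt]; lia.
Qed.

Lemma expseqs_uniq l m k : uniq (expseqs l m k).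
Proof.
elim: l m k => [|l IHl] m k; first by rewrite expseqs0l; case: ifP.
elim: m k => [|m IHm] k.
  by rewrite expseqsS0 map_inj_uniq // => u v [].
rewrite expseqsSS cat_uniq map_inj_uniq ?IHl => [|u v []//].
case: ifP => //= lk; apply/andP; split.
  by apply/hasPn => _ /mapP[t _ ->]; apply/mapP => -[].
rewrite map_inj_in_uniq //; move=> [|a s] [|b t];
  by rewrite ?[_ \in _]mem_expseqs //= => _ _ [-> ->].
Qed.

Lemma seqwtE s : seqwt s = \sum_(i < size s) (size s - i.+1) * nth 0 s i.
Proof.
elim: s => [|a s IH] /=; first by rewrite big_ord0.
by rewrite big_ord_recl /= subn1 IH.
Qed.

(** * Monomials of given degree and weight *)

Section Monomials.
Variables l m k : nat.

Definition isomnms : seq 'X_{1..l.+1} :=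
  [seq [multinom nth 0 s i | i < l.+1] | s <- expseqs l m k].

Lemma size_isomnms : size isomnms = npart l m k.
Proof. by rewrite size_map. Qed.

Lemma mem_isomnms (u : 'X_{1..l.+1}) : (u \in isomnms) =
  (mdeg u == m) && (\sum_(i < l.+1) (l - i) * u i == k).
Proof.
have szu : size (multinom_val u) = l.+1 by rewrite size_tuple.
have uE : u = [multinom nth 0 (multinom_val u) i | i < l.+1].
  by apply/mnmP => i; rewrite mnmE -mnm_nth.
have uin : (u \in isomnms) = (val (multinom_val u) \in expseqs l m k).
  apply/mapP/idP => [[s sin ->]|uin]; last by exists (val (multinom_val u)).
  have sz : size s = l.+1 by move: sin; rewrite mem_expseqs => /and3P[/eqP].
  suff -> : val (multinom_val [multinom nth 0 s i | i < l.+1]) = s by [].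
  apply: (@eq_from_nth _ 0); first by rewrite size_tuple.
  move=> i; rewrite size_tuple => il.
  by rewrite -[i]/(val (Ordinal il)) -mnm_nth mnmE.
rewrite uin mem_expseqs szu eqxx seqwtE szu /= /mdeg sumnE.
congr (_ && (_ == _)); apply: eq_bigr => i _.
by rewrite subSS -mnm_nth.
Qed.

Lemma isomnms_uniq : uniq isomnms.
Proof.
rewrite map_inj_in_uniq ?expseqs_uniq // => s t.
rewrite !mem_expseqs => /and3P[/eqP ss _ _] /and3P[/eqP st _ _] est.
apply: (@eq_from_nth _ 0); rewrite ?ss ?st // => i il.
by have /mnmP/(_ (Ordinal il)) := est; rewrite !mnmE.
Qed.

End Monomials.

(** * Highest weight vectors and growth *)

Section Growth.
Local Open Scope ring_scope.

(** The coefficient matrix has more rows than columns, hence a nonzero left kernel. *)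
Lemma mpoly_dependent (F : fieldType) n (s : seq 'X_{1..n}) q
    (f : 'I_q -> {mpoly F[n]}) : (size s < q)%N ->
  (forall i u, (f i)@_u != 0 -> u \in s) ->
  exists2 v : 'I_q -> F, (exists i, v i != 0) & \sum_i v i *: f i = 0.
Proof.
move=> sq fs.
pose A := \matrix_(i < q, j < size s) (f i)@_(tnth (in_tuple s) j).
have : kermx A != 0.
  rewrite kermx_eq0 /row_free; have := rank_leq_col A; lia.
rewrite -nz_row_eq0; set v := nz_row _ => vn0.
have vA : v *m A = 0 by apply/sub_kermxP/nz_row_sub.
exists (v 0).
  have /rV0Pn[i vi] := vn0; by exists i.
apply/mpolyP => u; rewrite mcoeff0 raddf_sum /=.
have [us|us] := boolP (u \in s); last first.
  rewrite big1 // => i _; rewrite mcoeffZ.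
  have [->|/eqP fu] := eqVneq (f i)@_u 0; first by rewrite mulr0.
  by rewrite (fs i) // in us; apply/eqP.
have iu : (index u s < size s)%N by rewrite index_mem.
have /matrixP/(_ 0 (Ordinal iu)) := vA; rewrite !mxE => E.
rewrite -[RHS]E; apply: eq_bigr => i _.
by rewrite mxE mcoeffZ (tnth_nth u) /= nth_index.
Qed.

Lemma isobaric_support l m k (p : {mpoly rat[l.+1]}) u :
  isobaric m%:R k%:R p -> p@_u != 0 -> u \in isomnms l m k.
Proof.
move=> hp pu; have [/eqP + /eqP] := isobaric_mcoeff hp pu.
by rewrite !eqr_nat mem_isomnms => -> ->.
Qed.

Lemma isomnmsP l m k u : u \in isomnms l m k -> isobaric m%:R k%:R 'X_[u].
Proof. by rewrite mem_isomnms => /andP[/eqP <- /eqP <-]; apply: isobaricX. Qed.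

(** The case [k = 0] follows the convention [p_(-1) = 0], since [p_0 = 1]. *)
Definition growth l m k := (k == 0%N) || (npart l m k.-1 < npart l m k)%N.

Definition highest_weight l m k (p : {mpoly rat[l.+1]}) :=
  [/\ p != 0, isobaric m%:R k%:R p & lowering p = 0].

(** [lowering] maps the weight [k] space to the smaller weight [k - 1] space, so it has a kernel. *)
Lemma highest_weight_exists l m k :
  growth l m k -> exists p, @highest_weight l m k p.
Proof.
(* Monomials that may occur after lowering; there are none when [k = 0]. *)
move=> gr; pose s := if k is k'.+1 then isomnms l m k' else [::].
have sz : (size s < npart l m k)%N.
  by rewrite {}/s; case: k gr => [|k]; rewrite ?npart_weight0 ?size_isomnms.
have hs (p : {mpoly rat[l.+1]}) u :
    isobaric m%:R k%:R p -> (lowering p)@_u != 0 -> u \in s.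
  move=> /isobaric_lowering; rewrite {sz}/s; case: k {gr} => [|k] /= hp.
    by rewrite (isobaric_lt0 hp) ?mcoeff0 ?eqxx // sub0r oppr_lt0 ltr01.
  by apply: isobaric_support; move: hp; rewrite mulrSr addrK.
pose x (i : 'I_(npart l m k)) : {mpoly rat[l.+1]} :=
  'X_[nth 0%MM (isomnms l m k) i].
have hx i : isobaric m%:R k%:R (x i).
  by apply/isomnmsP/mem_nth; rewrite size_isomnms.
have [v [i vi] v0] := mpoly_dependent sz (fun i u => @hs (x i) u (hx i)).
exists (\sum_i v i *: x i); split.
- apply: contra_neq vi => /mpolyP/(_ (nth 0%MM (isomnms l m k) i)).
  rewrite raddf_sum mcoeff0 (bigD1 i) //= big1 => [|j ji]; last first.
    rewrite mcoeffZ mcoeffX nth_uniq ?size_isomnms ?isomnms_uniq //.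
    by rewrite val_eqE (negbTE ji) mulr0.
  by rewrite mcoeffZ mcoeffX eqxx mulr1 addr0.
- exact: isobaric_sum.
- rewrite -[RHS]v0 /lowering linear_sum /=.
  by apply: eq_bigr => j _; rewrite linearZ.
Qed.

(** Without growth, [p] and the raised monomials of weight [k - 1] would be too many vectors for the
    weight [k] space. A dependency among them contradicts injectivity of [lowering o raising]. *)
Lemma highest_weight_growth l m k p :
  (2 * k <= l * m)%N -> @highest_weight l m k p -> growth l m k.
Proof.
case: k => // k lk [pn0 hp p0]; rewrite /growth /= ltnNge; apply/negP => le.
pose x (i : 'I_(npart l m k)) : {mpoly rat[l.+1]} :=
  'X_[nth 0%MM (isomnms l m k) i].
have hx i : isobaric m%:R k%:R (x i).
  by apply/isomnmsP/mem_nth; rewrite size_isomnms.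
pose F (i : 'I_(npart l m k).+1) :=
  if unlift ord0 i is Some j then raising (x j) else p.
have hF i u : (F i)@_u != 0 -> u \in isomnms l m k.+1.
  apply: isobaric_support; rewrite /F; case: unlift => // j.
  by rewrite mulrSr; apply: isobaric_raising.
have [|v [i vi]] := mpoly_dependent _ hF; first by rewrite size_isomnms ltnS.
rewrite big_ord_recl /F unlift_none.
under eq_bigr => j _ do rewrite liftK.
pose q := \sum_j v (lift ord0 j) *: x j.
have -> : \sum_j v (lift ord0 j) *: raising (x j) = raising q.
  by rewrite /raising linear_sum; apply: eq_bigr => j _; rewrite linearZ.
(* Lowering the dependency kills its [p] term and leaves [lowering (raising q) = 0]. *)
move=> E; have q0 : q = 0.
  apply: (lowering_raising_inj (d := m) (k := k)); last 2 first.
  - lia.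
  - have : lowering (v ord0 *: p + raising q) = 0 by rewrite E /lowering linear0.
    by rewrite {1}/lowering linearD linearZ /= -!/(lowering _) p0 scaler0 add0r.
  exact: isobaric_sum.
move: E; rewrite q0 /raising linear0 addr0 => /eqP.
rewrite scaler_eq0 (negbTE pn0) orbF => /eqP v0.
case/negP: vi; case: (unliftP ord0 i) => [j|] ->; last by rewrite v0.
have /mpolyP/(_ (nth 0%MM (isomnms l m k) j)) := q0.
rewrite raddf_sum mcoeff0 (bigD1 j) //= big1 => [|i' ij]; last first.
  rewrite mcoeffZ mcoeffX nth_uniq ?size_isomnms ?isomnms_uniq //.
  by rewrite val_eqE (negbTE ij) mulr0.
by rewrite mcoeffZ mcoeffX eqxx mulr1 addr0 => ->.
Qed.

(* The product of two highest weight vectors is one, as [{mpoly rat[l.+1]}] is a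
   domain and [lowering] a derivation. *)
Lemma growthD l a b i j : (2 * i <= l * a)%N -> (2 * j <= l * b)%N ->
  growth l a i -> growth l b j -> growth l (a + b) (i + j).
Proof.
move=> ia jb /highest_weight_exists[p [p0 hp lp]].
move=> /highest_weight_exists[q [q0 hq lq]].
apply: (@highest_weight_growth _ _ _ (p * q)); first lia.
split; first by rewrite mulf_neq0.
  by rewrite !natrD; apply: isobaricM.
by rewrite /lowering derM -!/(lowering _) lp lq mul0r mulr0 addr0.
Qed.

End Growth.

(** * Strictness of the ascending half and its additivity *)

Definition strict_up l m :=
  forall k, 2 <= k -> 2 * k <= l * m -> npart l m k.-1 < npart l m k.

(** Write [k = i + j] and use [growthD]. Neither summand may be 1, because [p_0 = p_1]. Evenness of
    [l * b] lets the two half-ranges add up to the half-range of the sum. *)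
Lemma strict_upD l a b : 6 <= l * a -> 4 <= l * b -> ~~ odd (l * b) ->
  strict_up l a -> strict_up l b -> strict_up l (a + b).
Proof.
move=> la lb eb sa sb k k2 kle.
suff : growth l (a + b) k by rewrite /growth; case: k k2 {kle}.
have ga i : i != 1 -> 2 * i <= l * a -> growth l a i.
  by case: i => // -[|i] // _ ile; apply/orP; right; apply: sa.
have gb i : i != 1 -> 2 * i <= l * b -> growth l b i.
  by case: i => // -[|i] // _ ile; apply/orP; right; apply: sb.
have [i [j [-> [i1 ia] [j1 jb]]]] : exists i j, [/\ k = i + j,
    i != 1 /\ 2 * i <= l * a & j != 1 /\ 2 * j <= l * b].
  move: la lb eb kle; rewrite mulnDr; move: (l * a) (l * b) => A B la lb eb kle.
  (* The first half-range is filled before the second. If that leaves [j = 1], one unit is moved to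
     get [j = 2]; the bounds 6 and 4 make [i = A./2 - 1] differ from 1 and [j = 2] admissible. *)
  have [kA|kA] := leqP (2 * k) A; first by exists k, 0; split; try split; lia.
  have [kA'|kA'] := leqP (k - A./2) 1; last first.
    by exists A./2, (k - A./2); split; try split; lia.
  by exists (A./2.-1), 2; split; try split; lia.
by apply: growthD => //; [apply: ga|apply: gb].
Qed.

(** * Gaussian binomials *)

Section GaussBinom.
Local Open Scope ring_scope.

Lemma gauss_numSl l m :
  gauss_num l.+1 m = ('X^(m.+1) - 1) * gauss_num l m.+1.
Proof.
rewrite /gauss_num big_nat_recl // addn1; congr (_ * _).
by apply: eq_big_nat => i _; rewrite addnS addSn.
Qed.

Lemma gauss_numSr l m :
  gauss_num l.+1 m = gauss_num l m * ('X^(m + l.+1) - 1).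
Proof. by rewrite /gauss_num big_nat_recr. Qed.

Lemma gauss_denS l : gauss_den l.+1 = gauss_den l * ('X^(l.+1) - 1).
Proof. by rewrite /gauss_den big_nat_recr. Qed.

Lemma gauss_den_neq0 l : gauss_den l != 0.
Proof. exact/monic_neq0/gauss_den_monic. Qed.

Lemma gauss_binomSS l m : gauss_binom l.+1 m.+1 =
  gauss_binom l m.+1 + 'X^(l.+1) * gauss_binom l.+1 m.
Proof.
apply: (mulIf (gauss_den_neq0 l.+1)); rewrite gauss_binomE mulrDl.
rewrite -mulrA gauss_binomE gauss_denS mulrA gauss_binomE.
rewrite gauss_numSr gauss_numSl exprD; ring.
Qed.

Lemma gauss_binom0l m : gauss_binom 0 m = 1.
Proof.
by rewrite /gauss_binom /gauss_num /gauss_den !big_geq // divp1.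
Qed.

Lemma gauss_binoml0 l : gauss_binom l 0 = 1.
Proof.
by apply: (mulIf (gauss_den_neq0 l)); rewrite gauss_binomE mul1r.
Qed.

Lemma gauss_num_den l m : gauss_num l m * gauss_den m = gauss_den (m + l).
Proof.
elim: l => [|l IH]; first by rewrite /gauss_num big_geq // mul1r addn0.
by rewrite gauss_numSr mulrAC IH addnS gauss_denS.
Qed.

Lemma gauss_binomC l m : gauss_binom l m = gauss_binom m l.
Proof.
apply: (mulIf (gauss_den_neq0 l)); apply: (mulIf (gauss_den_neq0 m)).
rewrite gauss_binomE [RHS]mulrAC gauss_binomE !gauss_num_den.
by rewrite addnC.
Qed.

(** Both sides satisfy the same q-Pascal rule with the same borders. *)
Lemma pcoef_npart l m k : pcoef l m k = (npart l m k)%:Z.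
Proof.
rewrite /pcoef; elim: l m k => [|l IHl] m k.
  by rewrite gauss_binom0l coef1 npart0l; case: eqP.
elim: m k => [|m IHm] k.
  by rewrite gauss_binoml0 coef1 npartl0; case: eqP.
rewrite gauss_binomSS npartSS coefD coefXnM IHl PoszD ltnS; congr (_ + _).
by case: ltnP => // lk; rewrite IHm.
Qed.

End GaussBinom.

Lemma npartC l m k : npart l m k = npart m l k.
Proof. by apply/eqP; rewrite -eqz_nat -!pcoef_npart /pcoef gauss_binomC. Qed.

Lemma npartSS' l m k : npart l.+1 m.+1 k =
  npart l.+1 m k + (if m < k then npart l m.+1 (k - m.+1) else 0).
Proof. by rewrite npartC npartSS npartC [npart m.+1 l _]npartC. Qed.

Lemma npart_gt l m k : l * m < k -> npart l m k = 0.
Proof.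
elim: l m k => [|l IHl] m k; first by rewrite npart0l; case: k.
elim: m k => [|m IHm] k lk; first by rewrite npartl0; case: k lk.
rewrite npartSS IHl; last by rewrite mulSn in lk; lia.
by case: ltnP => // lk'; rewrite IHm //; lia.
Qed.

(** Expanding at [a] by one Pascal rule and at [b] by the transposed one makes the summands
    correspond crosswise. *)
Lemma npart_sym l m a b : a + b = l * m -> npart l m a = npart l m b.
Proof.
elim: l m a b => [|l IHl] m a b; first by case: a; case: b.
elim: m a b => [|m IHm] a b; first by rewrite muln0; case: a; case: b.
move=> ab; rewrite npartSS npartSS' addnC; congr (_ + _).
  case: ltnP => la; first by apply: IHm; lia.
  by rewrite npart_gt //; lia.
case: ltnP => mb; first by apply: IHl; lia.
by rewrite npart_gt //; lia.
Qed.

Lemma strict_upC l m : strict_up l m -> strict_up m l.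
Proof. by move=> s k; rewrite [m * l]mulnC ![npart m l _]npartC; apply: s. Qed.

Lemma strict_chainP l m : strict_chain l m <-> strict_up l m.
Proof.
have E : (l * m)./2 + uphalf (l * m) = l * m by lia.
split=> [[up _ _] k k2 kle|s].
  have := up k.-1; rewrite !pcoef_npart prednK; last lia.
  by apply; lia.
split=> [n n1 nl||n n1 nl]; rewrite !pcoef_npart.
- by rewrite ltz_nat; apply: (s n.+1); lia.
- by rewrite (npart_sym E).
rewrite ltz_nat (@npart_sym l m n.+1 (l * m - n.+1)); last lia.
rewrite (@npart_sym l m n (l * m - n)); last lia.
have -> : l * m - n.+1 = (l * m - n).-1 by lia.
by apply: s; lia.
Qed.

(** * Boxes with l <= 4 *)

(** Two Pascal steps keep the parity of the second side, on which the position of the middle weight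
    depends. *)
Lemma npartSSS l m k : npart l.+1 m.+2 k =
  npart l m.+2 k + (if l < k then npart l.+1 m (k - l.+1) else 0)
  + (if m + l.+1 < k then npart l m.+1 (k - (m + l.+2)) else 0).
Proof.
rewrite npartSS; case: ltnP => lk; last by case: ltnP => //; lia.
rewrite npartSS' addnA.
have -> : (m < k - l.+1) = (m + l.+1 < k) by lia.
by have -> : k - l.+1 - m.+1 = k - (m + l.+2) by lia.
Qed.

Lemma npart1 m k : npart 1 m k = (k <= m).
Proof.
elim: m k => [|m IH] k; first by rewrite npartl0; case: k.
by rewrite npartSS npart0l IH; case: k => //= k; rewrite subn1.
Qed.

Lemma npart2 m k : npart 2 m k =
  if k <= m then k./2.+1 else if k <= 2 * m then (2 * m - k)./2.+1 else 0.
Proof.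
elim: m k => [|m IH] k; first by rewrite npartl0; case: k.
rewrite npartSS npart1 IH; case: k => [|[|k]] //.
have -> : (k.+2 <= 2 * m.+1) = (k <= 2 * m) by lia.
have -> : 2 * m.+1 - k.+2 = 2 * m - k by lia.
rewrite subn2 ltnS ltnS /=.
have [km|km] := leqP k m; last first.
  by rewrite ltnNge ltnW // ltnW.
have -> : k <= 2 * m by lia.
case: ltnP => // mk.
have -> : k = m by lia.
by have -> : 2 * m - m = m by lia.
Qed.

Lemma npart2_low m k : k <= m -> npart 2 m k = k./2.+1.
Proof. by rewrite npart2 => ->. Qed.

Lemma npart2_high m k : m <= k <= 2 * m -> npart 2 m k = (2 * m - k)./2.+1.
Proof.
move=> /andP[mk km]; rewrite npart2 km; case: leqP => // km'.
have -> : k = m by lia.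
by have -> : 2 * m - m = m by lia.
Qed.

(** The chain stalls at [p_2 = p_3 = 2]. *)
Lemma strict_up2 m : 2 < m -> ~ strict_up 2 m.
Proof.
move=> m3 /(_ 3 isT); rewrite leq_pmul2l // m3 => /(_ isT).
by rewrite !npart2_low //=; lia.
Qed.

Lemma npart3_odd j : npart 3 (2 * j).+1 (3 * j).+1 = npart 3 (2 * j).+1 (3 * j).
Proof.
(* Small cases are computed, since the last term of [npartSSS] is present at both weights only for
   [j >= 2]. *)
elim: j => // -[|[|j]] // /eqP IH; apply/eqP; move: IH.
move: j.+2 (erefl : 1 < j.+2) => {}j j2.
have -> : (2 * j.+1).+1 = (2 * j).+3 by lia.
rewrite (npartSSS 2 _ (3 * j.+1).+1) (npartSSS 2 _ (3 * j.+1)).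
have -> : 2 < (3 * j.+1).+1 by lia.
have -> : 2 < 3 * j.+1 by lia.
have -> : (2 * j).+1 + 3 < (3 * j.+1).+1 by lia.
have -> : (2 * j).+1 + 3 < 3 * j.+1 by lia.
rewrite !(@npart2_high (2 * j).+3); [|lia..].
rewrite !(@npart2_low (2 * j).+2); [|lia..].
have -> : (3 * j.+1).+1 - 3 = (3 * j).+1 by lia.
have -> : 3 * j.+1 - 3 = 3 * j by lia.
lia.
Qed.

(** The last two increments before the middle are [1 - odd j] and [odd j], so exactly one of them
    vanishes. *)
Lemma npart3_even j : 0 < j ->
  npart 3 (2 * j) (3 * j) + odd j = npart 3 (2 * j) (3 * j).-1 + 1 /\
  npart 3 (2 * j) (3 * j).-1 = npart 3 (2 * j) (3 * j).-2 + odd j.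
Proof.
case: j => // j _; elim: j => // -[|[|j]] // IH; move: IH.
move: j.+3 (erefl : 2 < j.+3) => {}j j3.
have -> : 2 * j.+1 = (2 * j).+2 by lia.
rewrite (npartSSS 2 _ (3 * j.+1)) (npartSSS 2 _ (3 * j.+1).-1).
rewrite (npartSSS 2 _ (3 * j.+1).-2).
have -> : 2 < 3 * j.+1 by lia.
have -> : 2 < (3 * j.+1).-1 by lia.
have -> : 2 < (3 * j.+1).-2 by lia.
have -> : 2 * j + 3 < 3 * j.+1 by lia.
have -> : 2 * j + 3 < (3 * j.+1).-1 by lia.
have -> : 2 * j + 3 < (3 * j.+1).-2 by lia.
rewrite !(@npart2_high (2 * j).+2); [|lia..].
rewrite !(@npart2_low (2 * j).+1); [|lia..].
have -> : 3 * j.+1 - 3 = 3 * j by lia.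
have -> : (3 * j.+1).-1 - 3 = (3 * j).-1 by lia.
have -> : (3 * j.+1).-2 - 3 = (3 * j).-2 by lia.
lia.
Qed.

Lemma strict_up3 m : 2 < m -> ~ strict_up 3 m.
Proof.
move=> m3 s; have mE := odd_double_half m.
have [om|em] := boolP (odd m).
  have E := npart3_odd m./2; have mE' : (2 * m./2).+1 = m by lia.
  by have := s (3 * m./2).+1; rewrite mE' in E; rewrite /= E ltnn; lia.
have {}mE : m = 2 * m./2 by lia.
have j0 : 0 < m./2 by lia.
have [E1 E2] := npart3_even j0; rewrite -mE in E1 E2.
have [oj|ej] := boolP (odd m./2).
  have := s (3 * m./2); lia.
have := s (3 * m./2).-1; lia.
Qed.

(** For [k <= m] the side [m] imposes no constraint, and the increment counts partitions of [k] into
    parts 2 and 3. *)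
Lemma npart3_low m k : 0 < k <= m ->
  npart 3 m k = npart 3 m k.-1 + (k %/ 6 + (k %% 6 != 1)).
Proof.
elim: m k => [|m IH] k; first by case: k.
move=> /andP[k0 km]; rewrite !(npartSS 2 m).
rewrite !(@npart2_low m.+1); [|lia..].
have [k3|k3] := leqP k 3.
  by case: k k0 k3 {km} => [|[|[|[|k]]]] // _ _; rewrite /= ?subnn ?npart_weight0.
have -> : 2 < k by lia.
have -> : 2 < k.-1 by lia.
have -> : k.-1 - 3 = (k - 3).-1 by lia.
rewrite (IH (k - 3)); lia.
Qed.

(** Induction from [m] to [m + 2]: the terms with first side 3 have equal sums at the two
    weights. *)
Lemma npart4_middle m : 0 < m -> npart 4 m (2 * m).-1 = npart 4 m (2 * m).-2.
Proof.
elim/ltn_ind: m => -[|[|[|[|[|m]]]]] // IH _.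
move: (IH m.+3 (ltnW (ltnSn _)) isT).
move: m.+3 (erefl : 2 < m.+3) => {IH}m m3 IH.
have -> : (2 * m.+2).-1 = 2 * m + 3 by lia.
have -> : (2 * m + 3).-1 = 2 * m + 2 by lia.
rewrite !(npartSSS 3 m).
have -> : 3 < 2 * m + 3 by lia.
have -> : 3 < 2 * m + 2 by lia.
have -> : m + 4 < 2 * m + 3 by lia.
have -> : m + 4 < 2 * m + 2 by lia.
have -> : 2 * m + 3 - 4 = (2 * m).-1 by lia.
have -> : 2 * m + 2 - 4 = (2 * m).-2 by lia.
have -> : 2 * m + 3 - (m + 5) = m - 2 by lia.
have -> : 2 * m + 2 - (m + 5) = (m - 2).-1 by lia.
(* Reflection in the middle brings these weights within reach of [npart3_low], after one Pascal
   step. *)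
rewrite (@npart_sym 3 m.+2 (2 * m + 3) (m + 3)); last lia.
rewrite (@npart_sym 3 m.+2 (2 * m + 2) (m + 4)); last lia.
rewrite !(npartSS 2 m.+1) !(@npart2_high m.+2); [|lia..].
have -> : 2 < m + 3 by lia.
have -> : 2 < m + 4 by lia.
have -> : m + 3 - 3 = m.+1.-1 by lia.
have -> : m + 4 - 3 = m.+1 by lia.
(* The increments at [m + 1] and [m - 2] differ by the number of partitions of [m + 1] into twos,
   which is [odd m]; the closed forms for first side 2 differ by the same amount. *)
rewrite (@npart3_low m.+1 m.+1) ?leqnn // (@npart3_low m.+1 (m - 2)); last lia.
lia.
Qed.

Lemma strict_up4 m : 2 < m -> ~ strict_up 4 m.
Proof.
move=> m3 /(_ (2 * m).-1); rewrite npart4_middle ?ltnn; lia.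
Qed.

(** * Computed boxes and the induction on the box *)

Fixpoint addN (s t : seq N) : seq N :=
  match s, t with
  | [::], _ => t
  | _, [::] => s
  | a :: s', b :: t' => N.add a b :: addN s' t'
  end.

Lemma nth_addN s t k : nth N0 (addN s t) k = N.add (nth N0 s k) (nth N0 t k).
Proof.
elim: s t k => [|a s IH] [|b t] [|k] //=; by rewrite ?nth_nil ?N.add_0_r.
Qed.

(** Entry [m] lists the coefficients for the box [(l, m)], in binary for fast evaluation. Prepending
    [l] zeros is multiplication by [q^l] in the q-Pascal rule. *)
Fixpoint gauss_row (l M : nat) : seq (seq N) :=
  if l is l'.+1 then
    [:: 1%num] :: scanl (fun acc s => addN s (ncons l N0 acc)) [:: 1%num]
      (behead (gauss_row l' M))
  else nseq M.+1 [:: 1%num].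

Lemma gauss_rowS l M : gauss_row l.+1 M =
  [:: 1%num] :: scanl (fun acc s => addN s (ncons l.+1 N0 acc)) [:: 1%num]
    (behead (gauss_row l M)).
Proof. by []. Qed.

Lemma nth_cons_scanl (T1 T2 : Type) (f : T1 -> T2 -> T1) x y0 x0 s n :
  n < size s -> nth x0 (x :: scanl f x s) n.+1 =
  f (nth x0 (x :: scanl f x s) n) (nth y0 s n).
Proof. by elim: s x n => // b s IH x [|n] //= ns; rewrite -IH. Qed.

Lemma size_gauss_row l M : size (gauss_row l M) = M.+1.
Proof.
by elim: l => [|l IH]; rewrite ?size_nseq //= size_scanl size_behead IH.
Qed.

Lemma nth_gauss_row l M m k : m <= M ->
  N.to_nat (nth N0 (nth [::] (gauss_row l M) m) k) = npart l m k.
Proof.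
elim: l m k => [|l IHl] m k mM.
  by rewrite nth_nseq ltnS mM npart0l; case: k => // k; rewrite /= nth_nil.
elim: m k mM => [|m IHm] k mM.
  by rewrite npartl0; case: k => // k; rewrite /= nth_nil.
rewrite gauss_rowS (nth_cons_scanl _ _ [::]) -?gauss_rowS; last first.
  by rewrite size_behead size_gauss_row.
rewrite nth_addN N2Nat.inj_add nth_behead IHl // npartSS nth_ncons ltnNge.
by case: leqP => lk; rewrite ?IHm // ltnW.
Qed.

Definition strictb (s : seq N) n :=
  all (fun k => N.ltb (nth N0 s k.-1) (nth N0 s k)) (iota 2 n.-1).

Lemma strict_upP l m M : m <= M ->
  reflect (strict_up l m) (strictb (nth [::] (gauss_row l M) m) (l * m)./2).
Proof.
move=> mM; have E k : N.ltb (nth N0 (nth [::] (gauss_row l M) m) k.-1)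
   (nth N0 (nth [::] (gauss_row l M) m) k) = (npart l m k.-1 < npart l m k).
  rewrite -!(@nth_gauss_row l M) //.
  by apply/idP/idP => [/N.ltb_lt|lt]; [|apply/N.ltb_lt]; lia.
apply: (iffP allP) => [s k k2 kle|s k].
  by rewrite -E s // mem_iota; lia.
by rewrite mem_iota E => kP; apply: s; lia.
Qed.

(** Comparing truth values settles both the strict boxes and the failure of the exceptional ones. *)
Definition check_rows (ls : seq nat) m0 M :=
  all (fun l => let r := gauss_row l M in
    all (fun m => strictb (nth [::] r m) (l * m)./2 ==
                  ((l, m) \notin exceptional))
        (iota (maxn l m0) (M.+1 - maxn l m0))) ls.

(** Exceptions end at [m = 14]; the eight columns 15 to 22 then start an induction by 8. *)
Lemma check_small : check_rows (iota 5 3) 5 22.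
Proof. by vm_compute. Qed.

(** The sides 8 to 15 represent every residue modulo 8; transposition covers [m < l]. *)
Lemma check_large : check_rows (iota 8 8) 8 15.
Proof. by vm_compute. Qed.

Lemma check_rowsP ls m0 M l m : check_rows ls m0 M -> l \in ls ->
  m0 <= m -> l <= m <= M -> strict_up l m <-> (l, m) \notin exceptional.
Proof.
move=> /allP H lls m0m /andP[lm mM]; move: (H l lls) => /allP/(_ m).
rewrite mem_iota => /(_ _)/eqP <-; last lia.
by split=> /(strict_upP _ mM).
Qed.

(** * Induction in steps of eight *)

(** The side 8 is even, as additivity needs, and occurs in no exceptional box. *)
Lemma strict_up_add8 l m : 5 <= l -> 5 <= m ->
  strict_up l m -> strict_up l 8 -> strict_up l (m + 8).
Proof. by move=> l5 m5; apply: strict_upD; nia. Qed.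

Lemma notin_exceptional l m :
  (8 <= l) || (15 <= m) -> (l, m) \notin exceptional.
Proof.
move=> lm; rewrite /exceptional !inE !xpair_eqE; lia.
Qed.

Lemma strict_up_small l m : 5 <= l <= 7 -> l <= m ->
  (l, m) \notin exceptional -> strict_up l m.
Proof.
move=> l57; elim/ltn_ind: m => m IH lm lmE.
have [m22|m22] := leqP m 22.
  apply/(check_rowsP check_small) => //; first by rewrite mem_iota; lia.
  - lia.
  - lia.
(* Now [m >= 23], so [m - 8 >= 15] lies beyond every exception. *)
have -> : m = (m - 8) + 8 by lia.
apply: strict_up_add8; [lia|lia| |].
  by apply: IH; [lia|lia|apply: notin_exceptional; lia].
apply/(check_rowsP check_small); [by rewrite mem_iota; lia|lia|lia|].
by rewrite /exceptional !inE !xpair_eqE; lia.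
Qed.

Lemma strict_up_base l m : 8 <= l <= 15 -> 8 <= m <= 15 -> strict_up l m.
Proof.
wlog lm : l m / l <= m.
  move=> H l8 m8; have [lm|ml] := leqP l m; first exact: H.
  by apply: strict_upC; apply: H => //; apply: ltnW.
move=> l8 m8.
apply/(check_rowsP check_large); [by rewrite mem_iota; lia|lia|lia|].
by apply: notin_exceptional; lia.
Qed.

Lemma strict_up_step l : 8 <= l ->
  (forall m, 8 <= m <= 15 -> strict_up l m) ->
  forall m, 8 <= m -> strict_up l m.
Proof.
move=> l8 base; elim/ltn_ind => m IH m8.
have [m15|m15] := leqP m 15; first by apply: base; rewrite m8.
have -> : m = (m - 8) + 8 by lia.
by apply: strict_up_add8; [lia|lia|apply: IH; lia|apply: base].
Qed.

(** With [m] fixed, [l] is reduced to the window 8 to 15; then, after transposing, [m] is. *)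
Lemma strict_up_large l m : 8 <= l -> 8 <= m -> strict_up l m.
Proof.
move=> l8 m8; apply: strict_upC; apply: strict_up_step l8 => // l' l'8.
apply: strict_upC; apply: strict_up_step m8; first lia.
by move=> m' m'8; apply: strict_up_base.
Qed.

Theorem theorem2p1 (l m : nat) (l_ge2 : (2 <= l)%N) (m_ge2 : (2 <= m)%N)
    (le_lm : (l <= m)%N) :
  strict_chain l m <->
  (l = 2 /\ m = 2) \/
  ((5 <= l)%N /\ (5 <= m)%N /\ (l, m) \notin exceptional).
Proof.
rewrite strict_chainP; split=> [s|[[-> ->]|[l5 [m5 lmE]]]].
- have [l5|l5] := leqP 5 l.
    right; split=> //; split; first lia.
    have [l8|l8] := leqP 8 l; first by apply: notin_exceptional; rewrite l8.
    have [m15|m15] := leqP 15 m.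
      by apply: notin_exceptional; rewrite m15 orbT.
    (* Only [5 <= l <= 7] and [m <= 14] remain, inside the computed table. *)
    by apply/(check_rowsP check_small) => //; [rewrite mem_iota|..]; lia.
  left; have [m2|m3] := leqP m 2; first by split; lia.
  case: l l_ge2 l5 s {le_lm} => [|[|[|[|[|l]]]]] // _ _ s; exfalso; move: s.
  + exact: strict_up2.
  + exact: strict_up3.
  + exact: strict_up4.
- by apply/(@strict_upP 2 2 2).
have [l8|l8] := leqP 8 l; last by apply: strict_up_small => //; lia.
by apply: strict_up_large => //; lia.
Qed.
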